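(* Let $R>1$, let $1\le c\le R$, and let $u_2$ be the second component of the vector field $u$ on $\Omega\setminus\{(0,0)\}$ described in the context. For points $(x_1,x_2)\neq(0,0)$ on the circle $\psi_c=1$, where $u_2(x_1,x_2)=c-x_1$, the limit of $u_2$ as $(x_1,x_2)$ tends to the origin depends on which member of the family of circles the origin is approached along; namely, along the circle $\psi_c=1$, $$\lim_{x_1\to 0}u_2(x_1,x_2)=c,$$ where the constant $c$ can be chosen arbitrarily in the range $1\le c\le R$. Moreover, the component $u_2$ when given by the expression $\frac{x_2^2-x_1^2}{2x_1}$ is indeterminate at the origin (it takes the form $0/0$ there), and its value there is not the limit of $u_2$ on any sequence of points belonging to a circle of the family.
   Context: For a constant $c>0$ put $\psi_c(x_1,x_2)=c^{-2}\{(x_1-c)^2+x_2^2\}$, so that $\psi_c=1$ is the circle of radius $c$ centred at $(c,0)$; all these circles touch at the origin. Fix $R>1$. The family of circles is $\{\psi_c=1\}$, $1\le c\le R$, and $\Omega\subset\mathbb{R}^2$ is the lens-shaped region filled by these circles, bounded internally by $\psi_1=1$ and externally by $\psi_R=1$. Each point of $\Omega\setminus\{(0,0)\}$ lies on exactly one circle of the family and has $x_1>0$. The vector field $u=(u_1,u_2)$ on $\Omega\setminus\{(0,0)\}$ is $u_1=x_2$, $u_2=\frac{x_2^2-x_1^2}{2x_1}$; at points of the circle $\psi_c=1$ other than the origin, $u_2=c-x_1$. *)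

(* Defs.v *)
From HB Require Import structures.
From mathcomp Require Import all_boot all_order all_algebra.
From mathcomp Require Import all_classical all_reals all_analysis.
Import Order.TTheory GRing.Theory Num.Theory.
Import numFieldNormedType.Exports.
Set Implicit Arguments.
Unset Strict Implicit.
Unset Printing Implicit Defensive.
Local Open Scope classical_set_scope.
Local Open Scope ring_scope.

Section Lens.
Variable K : realType.
Implicit Types (c R : K) (x : K * K).

Definition psi c x : K := c ^- 2 * ((x.1 - c) ^+ 2 + x.2 ^+ 2).

Definition circle c : set (K * K) := [set x | psi c x = 1].

Definition origin : K * K := (0, 0).

Definition Omega R : set (K * K) :=
  [set x | exists c, 1 <= c <= R /\ circle c x].

Definition u2_num x : K := x.2 ^+ 2 - x.1 ^+ 2.
Definition u2_den x : K := 2 * x.1.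

(* Division is total here (a / 0 = 0), so [u] also has a conventional value at
   the origin; as a vector field it is only meaningful on [Omega R `\ origin]. *)
Definition u x : K * K := (x.2, u2_num x / u2_den x).

Definition u2 x : K := (u x).2.

(* The value of the expression u2_num / u2_den where it has one: [None] where
   the denominator vanishes. *)
Definition u2_expr x : option K :=
  if u2_den x == 0 then None else Some (u2_num x / u2_den x).

Definition along_circle c : set_system (K * K) :=
  within (circle c `\ origin) (nbhs origin).

End Lens.
Arguments origin {K}.

(* Main.v *)
Require Import Defs.
From mathcomp Require Import all_boot all_order all_algebra.
From mathcomp Require Import all_classical all_reals all_analysis.
From mathcomp Require Import ring lra.
Import Order.TTheory GRing.Theory Num.Theory.
Import numFieldNormedType.Exports.
Local Open Scope classical_set_scope.
Local Open Scope ring_scope.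

(** The circle [psi_c = 1] has the equation [x1^2 + x2^2 = 2 c x1].  Off the
    origin this forces [x1 <> 0], since [x1 = 0] gives [x2 = 0]; substituting it for [x2^2] turns the
    quotient [(x2^2 - x1^2) / (2 x1)] into [c - x1] ([u2_circle]).  On a single
    circle [u2] is therefore a restriction of the continuous function [c - x1],
    and it tends to [c] at the origin.

    Two different circles give two different limits as soon as these limits are
    unique, that is, as soon as each circle does accumulate at the origin
    ([along_circle_proper]).  This is read off the rational parametrization of
    the circle by the lines through the origin ([circle_point]), which avoids
    square roots.

    The value of the expression at the origin is either absent (form 0/0) or,
    with the convention [a / 0 = 0], equal to [0]; a sequence on the circle
    converging to the origin has [u2] converging to [c >= 1], so its limit is
    neither. *)

Section CircleFamily.
Variable K : realType.
Implicit Types (c m : K) (x : K * K).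

(** Multiply [psi_c = 1] by [c^2] and cancel [c^2]. *)
Lemma circleE c x : c != 0 ->
  circle c x <-> x.1 ^+ 2 + x.2 ^+ 2 = 2 * c * x.1.
Proof.
move=> c0; have c20 : c ^+ 2 != 0 by rewrite expf_neq0.
rewrite /circle /psi /=; split=> [h|h].
- have : (x.1 - c) ^+ 2 + x.2 ^+ 2 = c ^+ 2.
    by rewrite -[LHS](mulVKf c20) h mulr1.
  by move=> e; nra.
- have -> : (x.1 - c) ^+ 2 + x.2 ^+ 2 = c ^+ 2 by nra.
  by rewrite mulVf.
Qed.

Lemma circle_fst_neq0 c x : c != 0 -> (circle c `\ origin) x -> x.1 != 0.
Proof.
move=> c0 [/(circleE _ x c0) h x0]; apply/eqP => x1; apply: x0.
move: h; rewrite x1 mulr0 expr0n add0r => /eqP; rewrite sqrf_eq0 => /eqP x2.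
by rewrite /= [x]surjective_pairing x1 x2.
Qed.

Lemma u2_circle c x : c != 0 -> (circle c `\ origin) x -> u2 x = c - x.1.
Proof.
move=> c0 cx; have x10 := circle_fst_neq0 c x c0 cx.
have /(circleE _ x c0) h := cx.1.
rewrite /u2 /u /u2_num /u2_den /=.
have -> : x.2 ^+ 2 = 2 * c * x.1 - x.1 ^+ 2 by rewrite -h; ring.
by field; rewrite x10.
Qed.

(** The second intersection of the circle with the line [x1 = m x2] through the
    origin; the line becomes the common tangent of the family as [m] tends to
    [0], which brings this intersection to the origin. *)
Definition circle_point c m : K * K :=
  (2 * c * m ^+ 2 / (1 + m ^+ 2), 2 * c * m / (1 + m ^+ 2)).

Lemma circle_pointP c m : c != 0 -> m != 0 ->
  (circle c `\ origin) (circle_point c m).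
Proof.
move=> c0 m0; have d0 : 1 + m ^+ 2 != 0.
  by rewrite gt_eqF// ltr_wpDr ?sqr_ge0.
split; first by apply/circleE => //=; field.
move=> /(congr1 snd) /= /eqP.
by rewrite !mulf_eq0 invr_eq0 (negbTE d0) (negbTE c0) (negbTE m0) pnatr_eq0.
Qed.

Lemma cvg_circle_point c : circle_point c m @[m --> (0 : K)] --> (origin : K * K).
Proof.
have d : (1 + m ^+ 2) @[m --> (0 : K)] --> (1 + 0 ^+ 2 : K).
  by apply: cvgD; [exact: cvg_cst|exact: exprn_continuous].
have dV : (1 + m ^+ 2)^-1 @[m --> (0 : K)] --> (1 + 0 ^+ 2 : K)^-1.
  by apply: cvgV d; rewrite expr0n addr0 oner_neq0.
have -> : (origin : K * K) = circle_point c 0.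
  by rewrite /circle_point /origin expr0n !mulr0 !mul0r.
have X : 2 * c * m ^+ 2 / (1 + m ^+ 2) @[m --> (0 : K)]
    --> 2 * c * 0 ^+ 2 / (1 + 0 ^+ 2).
  by apply: cvgM dV; apply: cvgM; [exact: cvg_cst|exact: exprn_continuous].
have Y : 2 * c * m / (1 + m ^+ 2) @[m --> (0 : K)]
    --> 2 * c * 0 / (1 + 0 ^+ 2).
  by apply: cvgM dV; apply: cvgM; [exact: cvg_cst|exact: cvg_id].
exact: cvg_pair X Y.
Qed.

#[local] Instance along_circle_filter c : Filter (along_circle c).
Proof. exact: within_filter. Qed.

(** Without properness the filter would converge to everything; it is what makes
    the limits along distinct circles unique and hence comparable. *)
Lemma along_circle_proper c : c != 0 -> ProperFilter (along_circle c).
Proof.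
move=> c0; apply: Build_ProperFilter_ex (along_circle_filter c) => A nA.
have nA0 : \forall m \near (0 : K)^',
    (circle c `\ origin) (circle_point c m) -> A (circle_point c m).
  by apply: nbhs_dnbhs; exact: (cvg_circle_point c _ nA).
have [m [Am m0]] := @filter_ex _ (0 : K)^' _ _
  (filterI nA0 (nbhs_dnbhs_neq (0 : K))).
by exists (circle_point c m); apply: Am; exact: circle_pointP.
Qed.

Lemma cvg_fst_along_circle c :
  x.1 @[x --> along_circle c] --> (0 : K).
Proof.
apply: cvg_trans; last exact: (@cvg_fst _ _ (nbhs (0 : K)) (nbhs (0 : K)) _).
by apply: cvg_app; exact: cvg_within.
Qed.

Lemma cvg_u2_along_circle c : c != 0 -> u2 x @[x --> along_circle c] --> c.
Proof.
move=> c0; apply: (@cvg_trans _ ((c - x.1) @[x --> along_circle c])).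
  apply: near_eq_cvg; rewrite /along_circle near_withinE; near=> x => cx.
  by rewrite (u2_circle c).
have : (c - x.1) @[x --> along_circle c] --> c - 0.
  by apply: cvgB; [exact: cvg_cst|exact: cvg_fst_along_circle].
by rewrite subr0.
Unshelve. all: by end_near. Qed.

Lemma cvg_u2_seq c (s : nat -> K * K) : c != 0 ->
  (forall n, (circle c `\ origin) (s n)) ->
  s n @[n --> \oo] --> (origin : K * K) -> u2 (s n) @[n --> \oo] --> c.
Proof.
move=> c0 cs s0.
have sc : s n @[n --> \oo] --> along_circle c.
  by move=> A /s0; apply: (@filterS _ \oo) => n; apply; exact: cs.
exact: cvg_comp sc (cvg_u2_along_circle c c0).
Qed.

End CircleFamily.

Theorem proposition4p1 (K : realType) (R : K) (hR : 1 < R) :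
  (* along each circle of the family, u2 = c - x1 tends to c *)
  (forall c : K, 1 <= c <= R ->
     [/\ forall x, (circle c `\ origin) x -> u2 x = c - x.1,
         u2 x @[x --> along_circle c] --> c
       & (* the same limit, taken as x1 tends to 0 on the circle *)
         forall e : K, 0 < e -> \forall t \near (0 : K),
           forall x, (circle c `\ origin) x -> x.1 = t -> `|u2 x - c| < e]) /\
  (* the limit depends on the circle *)
  (forall c c' : K, 1 <= c <= R -> 1 <= c' <= R -> c <> c' ->
     lim (u2 x @[x --> along_circle c]) <> lim (u2 x @[x --> along_circle c'])) /\
  (* the expression gives u2 off the origin, and has the form 0/0 there *)
  (forall x, (Omega R `\ origin) x -> u2_expr x = Some (u2 x)) /\
  [/\ u2_num (origin : K * K) = 0, u2_den (origin : K * K) = 0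
    & u2_expr (origin : K * K) = None] /\
  (* whether the quotient is undefined at the origin or evaluated there with
     the convention a / 0 = 0, its value is not a sequential limit of u2 *)
  (forall (c : K) (s : nat -> K * K), 1 <= c <= R ->
     (forall n, (circle c `\ origin) (s n)) ->
     (forall l : K, u2 (s n) @[n --> \oo] --> l -> u2_expr origin <> Some l) /\
     (s n @[n --> \oo] --> (origin : K * K) ->
        ~ (u2 (s n) @[n --> \oo] --> u2 (origin : K * K)))).
Proof.
have neq0 c : 1 <= c <= R -> c != 0.
  by move=> /andP[c1 _]; rewrite gt_eqF// (lt_le_trans ltr01).
have num0 : u2_num (origin : K * K) = 0 by rewrite /u2_num /= subrr.
have den0 : u2_den (origin : K * K) = 0 by rewrite /u2_den /= mulr0.
have expr0 : u2_expr (origin : K * K) = None by rewrite /u2_expr den0 eqxx.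
split; [|split; [|split; [|split]]].
- move=> c /neq0 c0; split.
  + by move=> x; exact: u2_circle.
  + exact: cvg_u2_along_circle.
  + move=> e e0; near=> t => x cx xt.
    rewrite (u2_circle _ c)// xt addrAC subrr add0r normrN.
    by near: t; exact: (@nbhs0_lt K K^o).
- move=> c c' /neq0 c0 /neq0 c0' cc'.
  (* These instances are what uniqueness of limits needs in [cvg_lim]. *)
  have pc := along_circle_proper K c c0.
  have pc' := along_circle_proper K c' c0'.
  have -> := cvg_lim (@norm_hausdorff _ _) (cvg_u2_along_circle K c c0).
  have -> // := cvg_lim (@norm_hausdorff _ _) (cvg_u2_along_circle K c' c0').
- move=> x [[c [/neq0 c0 cx] x0]].
  have x10 := circle_fst_neq0 K c x c0 (conj cx x0).
  by rewrite /u2_expr mulf_eq0 pnatr_eq0 (negbTE x10).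
- by [].
- move=> c s /neq0 c0 cs; split=> [l _|s0 us]; first by rewrite expr0.
  have u20 : u2 (origin : K * K) = 0 by rewrite /u2 /u /= num0 mul0r.
  have cu := cvg_u2_seq K c s c0 cs s0.
  move/eqP: c0; apply; rewrite -u20.
  exact: (cvg_unique (@norm_hausdorff _ _) cu us).
Unshelve. all: by end_near. Qed.
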